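(* For every integer $k$ there is an Eulerian oriented planar triangulation $G$, with tripartition (proper $3$-colouring) $I_1,I_2,I_3$, such that every permeating acyclic connected set $\mathcal{A}\subseteq V(G)$ satisfies $|\mathcal{A}\cap I_j|\ge k$ for each $j\in\{1,2,3\}$.
   Context: An oriented graph is a directed graph without directed cycles of length $1$ or $2$. An oriented graph is Eulerian if it is connected and every vertex has in-degree equal to out-degree. A planar triangulation is a (finite, simple) planar graph, considered with a plane embedding, all of whose faces, including the outer face, are triangles; an oriented planar triangulation is an oriented graph whose underlying undirected graph is a planar triangulation. The underlying graph of an Eulerian oriented planar triangulation has a unique partition of its vertex set into three independent sets, its tripartition (equivalently, a proper $3$-colouring unique up to permuting the colours). A set $\mathcal{A}$ of vertices of $G$ is acyclic if the subdigraph it induces has no directed cycle, connected if the underlying undirected graph of the induced subdigraph is connected, and permeating if every face of $G$ (including the outer face) has at least one vertex in $\mathcal{A}$. *)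

(* Defs.v *)
From HB Require Import structures.
From mathcomp Require Import all_boot all_order all_algebra all_fingroup.

Set Implicit Arguments.
Unset Strict Implicit.
Unset Printing Implicit Defensive.

(* A loop is a directed cycle of length 1, a pair of opposite arcs is a       *)
(* directed cycle of length 2.                                                *)
Record oriented_graph := OrientedGraph {
  vertex :> finType;
  arc : rel vertex;
  arc_irreflexive : irreflexive arc;
  arc_asymmetric : forall x y : vertex, arc x y -> ~~ arc y x
}.

Section Digraph.
Variable G : oriented_graph.

Definition adj : rel G := [rel x y | arc x y || arc y x].

Definition nbrs (v : G) : {set G} := [set u | adj v u].

Definition out_degree (v : G) : nat := #|[set u | arc v u]|.
Definition in_degree (v : G) : nat := #|[set u | arc u v]|.

(* The null graph is not connected. *)
Definition connected_set (A : {set G}) : Prop :=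
  A != set0 /\
  {in A &, forall x y,
    connect [rel u v : G | [&& u \in A, v \in A & adj u v]] x y}.

(* [ucycle e [::]] holds, hence the condition that [c] is nonempty. *)
Definition acyclic_set (A : {set G}) : Prop :=
  forall c : seq G, c != [::] -> {subset c <= A} -> ~ ucycle (@arc G) c.

Definition eulerian : Prop :=
  connected_set [set: G] /\ forall v : G, in_degree v = out_degree v.

Definition independent (A : {set G}) : Prop :=
  {in A &, forall x y, ~~ adj x y}.

Definition tripartition (I : 'I_3 -> {set G}) : Prop :=
  (forall x : G, exists! j : 'I_3, x \in I j) /\
  (forall j : 'I_3, independent (I j)).

(* An embedding of a connected graph in an oriented closed surface is given,  *)
(* up to homeomorphism, by a rotation system: for each vertex [v], the cyclic *)
(* order [rot v] of its neighbours around it (the values of [rot v] outside   *)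
(* of [nbrs v] play no role).  An edge traversed in a given direction is the  *)
(* pair [(u, v)] of its ends.  The boundary walk of the face lying on a given *)
(* side of [(u, v)] goes on with [(v, rot v u)], so the faces are the orbits  *)
(* of this map on the set of darts; each edge is on two sides of faces, one   *)
(* for each direction.                                                        *)
Variable rot : G -> {perm G}.

Definition rotation_system : Prop :=
  forall v u : G, u \in nbrs v -> porbit (rot v) u = nbrs v.

Definition darts : {set G * G} := [set d | adj d.1 d.2].

Definition face_next (d : G * G) : G * G := (d.2, rot d.2 d.1).

Definition face_of (d : G * G) : {set G * G} :=
  [set d' | fconnect face_next d d'].

Definition faces : {set {set G * G}} := [set face_of d | d in darts].

Definition face_vertices (F : {set G * G}) : {set G} := [set d.1 | d in F].

(* The surface is the sphere exactly when its Euler characteristic is 2.      *)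
(* The graph being oriented, its edges correspond to its arcs.  The graph     *)
(* with a single vertex, whose only face has no dart, is left out.            *)
Definition plane_embedding : Prop :=
  [/\ connected_set [set: G],
      rotation_system &
      #|G| + #|faces| = #|[set d : G * G | arc d.1 d.2]| + 2].

(* As [adj] is irreflexive, a closed walk of length 3 is a triangle. *)
Definition plane_triangulation : Prop :=
  plane_embedding /\ {in faces, forall F : {set G * G}, #|F| = 3}.

Definition permeating (A : {set G}) : Prop :=
  {in faces, forall F, exists2 v, v \in face_vertices F & v \in A}.

End Digraph.

Arguments eulerian : clear implicits.

(* Main.v *)
Require Import Defs.
From HB Require Import structures.
From mathcomp Require Import all_boot all_order all_algebra all_fingroup.
From mathcomp Require Import zify.

Set Implicit Arguments.
Unset Strict Implicit.
Unset Printing Implicit Defensive.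

Import GRing.Theory.

Local Notation arc := Defs.arc.

(** Triangulations are built up by gluing.  When two of them are glued along a
    facial triangle, that triangle separates the result, and because its three
    vertices are pairwise adjacent, a permeating acyclic connected set of the
    result (an [admissible] set) restricts to such a set on both sides
    ([restrict]): a walk that leaves one side through the triangle can be short-cut along one of its
    edges.  If the triangle is a directed cycle in both pieces, it contributes
    nothing to the balance of its vertices, so the result is Eulerian
    ([gluing]).

    It then suffices to find one fixed block in which every permeating acyclic
    connected set contains a vertex of colour 2 outside of the triangle used
    for gluing ([block_forces]).  Gluing in one more copy of it, with the
    colours shifted cyclically, adds 1 to the guaranteed number of vertices of
    any prescribed colour ([forcing_map]), and this can be repeated because the
    block has a second facial directed triangle, on which to glue the next copy.

    The block has 22 vertices.  Its vertices of colours 0 and 1 form a plane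
    bipartite graph H in which each face contains exactly one vertex of colour
    2.  For i modulo 4, H has vertices p_i, q_i and r_i: the p_i form a directed
    4-cycle (the equator), q_i is a twin of p_i, with arcs
    p_(i-1) -> q_i -> p_(i+1), and r_i has degree 2 in H, with neighbours p_i
    and q_i.  Even indices lie on one side of the equator, odd ones on the
    other.  The vertices of colour 2 are a_i, b_i and c_j, where a_i and b_i lie
    in the two faces of H at r_i, and c_j in the face q_j p_(j+1) q_(j+2) p_(j+3)
    for j = 0, 1.  The triangle used for gluing is q_0 p_1 c_0.

    Let A be admissible and contain no a_i and no b_i.  Each edge p_i p_(i+1),
    p_i r_i or q_i r_i lies on a face whose third vertex is one of these, so A
    meets all such edges.  As A is acyclic, it misses some p_i.  Then it contains
    the neighbours p_(i-1), p_(i+1) and r_i of p_i.  As A is connected and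
    is not reduced to r_i, it contains a neighbour of r_i, which can only be q_i.
    If it also contains q_(i+2), it contains the directed cycle
    p_(i-1) q_i p_(i+1) q_(i+2).
    Otherwise it contains r_(i+2), hence p_(i+2) by connectedness, and so the
    directed cycle p_(i-1) q_i p_(i+1) p_(i+2): a contradiction. *)

(** * Coloured Eulerian triangulations *)

Lemma adj_sym (G : oriented_graph) : symmetric (@adj G).
Proof. by move=> u v; rewrite /adj /= orbC. Qed.

Lemma adj_irr (G : oriented_graph) : irreflexive (@adj G).
Proof. by move=> u; rewrite /adj /= arc_irreflexive. Qed.

Lemma arc_adj (G : oriented_graph) (u v : G) : arc u v -> adj u v.
Proof. by rewrite /adj /= => ->. Qed.

(** An edge [u v] traversed from [u] to [v] has a face on a given side, and
    [third u v] is the third vertex of this face.  In terms of [third], gluing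
    is a plain case distinction, and a rotation system can be recovered from
    it: [third u v] is the successor of [u] around [v].  The axiom
    [link_connected] says that these successors run through all neighbours of
    [v] in a single cycle.  As all faces are triangles, Euler's formula amounts to
    [E + 6 = 3 * V], which needs no count of the faces. *)
Record eulerian_map := EulerianMap {
  map_graph :> oriented_graph;
  third : map_graph -> map_graph -> map_graph;
  color : map_graph -> 'I_3;
  third_adj : forall u v, adj u v -> adj v (third u v);
  third_face : forall u v, adj u v -> third v (third u v) = u;
  link_connected : forall v (P : pred map_graph),
    (exists2 u, adj u v & P u) ->
    (forall u, adj u v -> P u -> P (third u v)) ->
    forall u, adj u v -> P u;
  map_connected : forall u v : map_graph, connect (@adj _) u v;
  map_balanced : forall v : map_graph, in_degree v = out_degree v;
  map_euler : #|[set d : map_graph * map_graph | arc d.1 d.2]| + 6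
              = 3 * #|map_graph|;
  color_proper : forall u v, arc u v -> color u != color v
}.

Lemma color_adj (M : eulerian_map) (u v : M) : adj u v -> color u != color v.
Proof. by case/orP=> /color_proper //; rewrite eq_sym. Qed.

Section Rotation.
Variable M : eulerian_map.

Definition turn (v u : M) : M := if adj u v then third u v else u.

(** By [third_face], [u] is determined by [v] and [w = third u v], since it
    equals [third v w]. *)
Lemma turn_inj v : injective (turn v).
Proof.
have third_out u u' : adj u v -> ~~ adj u' v -> third u v <> u'.
  by move=> /third_adj uv + e; rewrite -e adj_sym uv.
move=> u u'; rewrite /turn.
case: ifP => uv; case: ifP => u'v // e.
- by rewrite -(third_face uv) e third_face.
- by case: (third_out u u' uv (negbT u'v) e).
- by case: (third_out u' u u'v (negbT uv) (esym e)).
Qed.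

Definition rotation (v : M) : {perm M} := perm (@turn_inj v).

Lemma rotationE u v : adj u v -> rotation v u = third u v.
Proof. by move=> uv; rewrite permE /turn uv. Qed.

Lemma rotationP : rotation_system rotation.
Proof.
move=> v u; rewrite inE => vu; apply/eqP; rewrite eqEsubset; apply/andP; split.
  apply/subsetP=> w /porbitP[n ->]; rewrite inE.
  elim: n => [|n IHn]; first by rewrite expg0 perm1.
  by rewrite expgSr permM rotationE ?third_adj // adj_sym.
apply/subsetP=> w; rewrite inE adj_sym => wv.
apply: (@link_connected M v [in porbit (rotation v) u]) wv.
  by exists u; rewrite ?porbit_id // adj_sym.
move=> x xv /porbitP[n xE] /=.
rewrite -rotationE // xE -permM -expgSr.
by apply/porbitP; exists n.+1.
Qed.

Local Notation next := (face_next rotation).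

Lemma next_inj : injective next.
Proof. by move=> [u v] [u' v'] [<-] /= /perm_inj ->. Qed.

Lemma nextE u v : adj u v -> next (u, v) = (v, third u v).
Proof. by move=> uv; rewrite /face_next /= rotationE. Qed.

Definition triangle (d : M * M) : seq (M * M) :=
  [:: d; (d.2, third d.1 d.2); (third d.1 d.2, d.1)].

Lemma triangle_cycle d : d \in darts M -> fcycle next (triangle d).
Proof.
case: d => u v; rewrite inE /= => uv.
have vw := third_adj uv; have wu : adj (third u v) u.
  by have := third_adj vw; rewrite third_face.
rewrite /= !nextE // (third_face uv) !eqxx /=.
by have := third_face vw; rewrite (third_face uv) => ->; rewrite eqxx.
Qed.

Lemma triangle_uniq d : d \in darts M -> uniq (triangle d).
Proof.
case: d => u v; rewrite inE /= => uv.
rewrite !inE !xpair_eqE /= !andbT.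
have neq (x y : M) : adj x y -> (x == y) = false.
  by move=> xy; apply: contraTF xy => /eqP->; rewrite adj_irr.
rewrite (neq _ _ uv) (neq v u) ?andbF 1?adj_sym //=.
by rewrite (neq v) ?third_adj //.
Qed.

Lemma face_ofP d d' : d \in darts M ->
  (d' \in face_of rotation d) = (d' \in triangle d).
Proof.
move=> dD; rewrite inE.
by rewrite (fconnect_cycle (triangle_cycle dD)) ?inE ?eqxx.
Qed.

Lemma face_card d : d \in darts M -> #|face_of rotation d| = 3.
Proof.
move=> dD.
rewrite cardsE -[#|_|]/(fingraph.order next d).
by rewrite (order_cycle (triangle_cycle dD) (triangle_uniq dD)) ?inE ?eqxx.
Qed.

(** The face map is injective, so lying on a common face is an equivalence. *)
Lemma faces_partition : partition (faces rotation) (darts M).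
Proof.
have faceD d d' : d \in darts M -> d' \in face_of rotation d -> d' \in darts M.
  move=> dD; rewrite face_ofP //; move: dD; case: d => u v; rewrite !inE /=.
  move=> uv; have vw := third_adj uv.
  case/or3P=> /eqP-> //=.
  by have := third_adj vw; rewrite third_face.
apply/and3P; split.
- rewrite /cover; apply/eqP/setP=> d; apply/bigcupP/idP.
    by case=> _ /imsetP[d' d'D ->]; apply: faceD.
  by move=> dD; exists (face_of rotation d); rewrite ?imset_f // inE connect0.
- apply/trivIsetP=> _ _ /imsetP[d dD ->] /imsetP[d' d'D ->].
  apply: contraR => /pred0Pn[x /= /andP[]]; rewrite !inE => dx d'x.
  apply/eqP/setP=> y; rewrite !inE.
  have sym := fconnect_sym next_inj.
  by apply: (same_connect sym); rewrite (connect_trans dx) // sym.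
- apply/imsetP=> -[d dD /setP/(_ d)].
  by rewrite !inE connect0.
Qed.

Lemma darts_card :
  #|darts M| = #|[set d : M * M | arc d.1 d.2]| * 2.
Proof.
pose swap (d : M * M) := (d.2, d.1).
have swap_inj : injective swap by case=> [a b] [c d] [-> ->].
set E := [set d | _]; have -> : darts M = E :|: swap @: E.
  apply/setP=> -[u v]; rewrite !inE /=; congr (_ || _).
  apply/idP/imsetP => [vu | [[x y]]]; first by exists (v, u); rewrite ?inE.
  by rewrite inE /= => xy [-> ->].
rewrite cardsU card_imset // (_ : E :&: _ = set0) ?cards0 ?subn0.
  by rewrite muln2 addnn.
apply/setP=> -[u v]; rewrite !inE /=; apply/negP=> /andP[uv].
case/imsetP=> -[x y]; rewrite inE /= => xy [ux vy].
by move: (arc_asymmetric xy); rewrite -ux -vy uv.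
Qed.

Lemma map_set_connected : connected_set [set: M].
Proof.
split.
  by rewrite -card_gt0 cardsT; have := map_euler M; case: #|M|; rewrite ?addnS.
move=> u v _ _; rewrite (eq_connect (e' := @adj M)) ?map_connected //.
by move=> x y /=; rewrite !inE.
Qed.

(** There are twice as many darts as arcs and three times as many as faces, which
    turns [map_euler] into Euler's formula. *)
Lemma map_triangulation : plane_triangulation rotation.
Proof.
split; last by move=> _ /imsetP[d dD ->]; apply: face_card.
split; [exact: map_set_connected | exact: rotationP |].
have faces3 : {in faces rotation, forall F : {set M * M}, #|F| = 3}.
  by move=> _ /imsetP[d dD ->]; apply: face_card.
have := card_uniform_partition faces3 faces_partition.
rewrite darts_card; have := map_euler M.
set E := #|_|; set n := #|M|; set f := #|faces _| => En Ef.
apply/eqP; rewrite -(eqn_pmul2l (isT : 0 < 3)) mulnDr -En (mulnC 3 f) -Ef.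
by apply/eqP; rewrite mulnDr addnAC -mulnS mulnC.
Qed.

Lemma map_permeating (A : {set M}) u v : permeating rotation A -> adj u v ->
  [|| u \in A, v \in A | third u v \in A].
Proof.
move=> permA uv; have uvD : (u, v) \in darts M by rewrite inE.
have [w] := permA _ (imset_f _ uvD).
case/imsetP=> d; rewrite face_ofP // !inE => /or3P[] /eqP-> /= -> ->;
  by rewrite ?orbT.
Qed.

Lemma map_tripartition : tripartition (fun j => [set x : M | color x == j]).
Proof.
split=> [x|j x y].
  by exists (color x); split=> [|j]; rewrite inE // => /eqP.
rewrite !inE => /eqP xj /eqP yj; apply/negP=> /color_adj.
by rewrite xj yj eqxx.
Qed.

End Rotation.

(** * Gluing along a triangle *)

(** The pushout of two injections, realised as the disjoint sum without the second
    copy of the common part. *)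
Lemma amalgam (A B K : finType) (f : K -> A) (g : K -> B) :
    injective f -> injective g ->
  exists (V : finType) (i : A -> V) (j : B -> V),
    [/\ injective i, injective j, forall k, i (f k) = j (g k),
        forall a b, i a = j b -> exists k, a = f k /\ b = g k &
        forall v, (exists a, v = i a) \/ (exists b, v = j b)].
Proof.
move=> f_inj g_inj; pose V : finType := (A + {b : B | b \notin codom g})%type.
have ex_j b : exists v : V, match v with
    | inl a => exists k, a = f k /\ b = g k
    | inr b' => b = val b' end.
  have [/codomP[k ->] | bg] := boolP (b \in codom g).
    by exists (inl (f k)); exists k.
  by exists (inr (exist _ b bg)).
have [j jP] := fin_all_exists ex_j; exists V, inl, j; split.
- by move=> a a' [].
- move=> b b' e; move: (jP b) (jP b'); rewrite e; case: (j b') => [a|c -> -> //].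
  by case=> k [-> ->] [l [/f_inj -> ->]].
- move=> k; move: (jP (g k)); case: (j (g k)) => [a [l [-> /g_inj ->]] //|c e].
  by have := valP c; rewrite -e codom_f.
- by move=> a b e; move: (jP b); rewrite -e.
- case=> [a|c]; first by left; exists a.
  right; exists (val c); move: (jP (val c)); case: (j (val c)) => [a|c' e].
    by case=> k [_ e]; have := valP c; rewrite e codom_f.
  by congr inr; apply: val_inj.
Qed.

Lemma ord3_add3 (k : 'I_3) : (k + 1 + 1 + 1 = k)%R.
Proof. by apply/val_inj; case: k => [[|[|[|]]]]. Qed.

Lemma ord3_neq (k l : 'I_3) : k != l -> (l == k + 1)%R || (k == l + 1)%R.
Proof. by case: k => [[|[|[|]]] ?] //; case: l => [[|[|[|]]] ?]. Qed.

Lemma ord3_addS (k : 'I_3) : (k == k + 1)%R = false.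
Proof. by case: k => [[|[|[|]]]]. Qed.

Lemma ord3_addSS (k : 'I_3) : (k == k + 1 + 1)%R = false.
Proof. by case: k => [[|[|[|]]]]. Qed.

Lemma ord3_third (k l : 'I_3) : k != l ->
  forall m, [|| m == k, m == l | m == - (k + l)]%R.
Proof.
by case: k l => [[|[|[|]]] ?] // [[|[|[|]]] ?] // _ [[|[|[|]]] ?].
Qed.

Section Roots.
Variables (M : eulerian_map) (t : 'I_3 -> M).

Definition cyclic_triangle :=
  forall k, color (t k) = k /\ arc (t k) (t (k + 1)%R).

(** The faces of a 3-colourable triangulation fall into two classes, according to
    the cyclic order of the colours along their boundary, and only faces of
    different classes can be identified.  A black root is a face whose boundary
    walk follows the arcs, that of a white root goes against them. *)
Definition black_root :=
  cyclic_triangle /\ forall k, third (t k) (t (k + 1)%R) = t (k + 1 + 1)%R.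

Definition white_root :=
  cyclic_triangle /\ forall k, third (t (k + 1)%R) (t k) = t (k + 1 + 1)%R.

(** In a gluing, a black root of one side is identified with a white root of the
    other one. *)
Definition seam (b : bool) := if b then white_root else black_root.

Hypothesis tP : cyclic_triangle.

Lemma triangle_inj : injective t.
Proof. by move=> k l e; case: (tP k) => <- _; rewrite e; case: (tP l). Qed.

Lemma triangle_arc k l : arc (t k) (t l) = (l == k + 1)%R.
Proof.
apply/idP/eqP=> [kl | ->]; last by case: (tP k).
have /ord3_neq : k != l.
  by apply: contraTneq kl => ->; rewrite arc_irreflexive.
case/orP=> /eqP // kE; case: (tP l) => _; rewrite -kE => lk.
by move: (arc_asymmetric kl); rewrite lk.
Qed.

Lemma triangle_adj k l : adj (t k) (t l) = (k != l).
Proof.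
apply/idP/idP => [|/ord3_neq].
  by apply: contraTneq => ->; rewrite adj_irr.
by rewrite /adj /= !triangle_arc.
Qed.

End Roots.

(** The first condition is permeation: every face is the face of some dart. *)
Definition admissible (M : eulerian_map) (A : {set M}) :=
  [/\ forall u v, adj u v -> [|| u \in A, v \in A | third u v \in A],
      acyclic_set A & connected_set A].

Section Gluing.

(** The two sides are indexed by booleans, so that all arguments valid for both
    are made once; [i_meet] says that they share only the triangle. *)
Variables (M : bool -> eulerian_map) (V : finType).
Variables (i : forall b, M b -> V) (t : forall b, 'I_3 -> M b).
Arguments i : clear implicits.
Hypothesis t_root : forall b, seam (@t b) b.
Hypothesis i_inj : forall b, injective (i b).
Hypothesis i_t : forall b c k, i b (t b k) = i c (t c k).
Hypothesis i_meet : forall b (x : M b) (y : M (~~ b)),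
  i b x = i (~~ b) y -> exists k, x = t b k /\ y = t (~~ b) k.
Hypothesis i_cover : forall v, exists b x, v = i b x.

Lemma t_cyclic b : cyclic_triangle (@t b).
Proof. by have := t_root b; case: b => -[]. Qed.
Let t_inj b := triangle_inj (@t_cyclic b).
Let arc_t b := triangle_arc (@t_cyclic b).
Let adj_t b := triangle_adj (@t_cyclic b).

(** Stated with [c = b] rather than [x = y], since [x] and [y] have different
    types; the equality of types can be substituted afterwards. *)
Lemma i_eq b c (x : M b) (y : M c) : i b x = i c y ->
  (exists k, x = t b k /\ y = t c k) \/ c = b.
Proof.
have [/eqP | cb] := boolP (c == b); first by right.
have cE : c = ~~ b by case: c b {x y} cb => [] [].
by move: y; rewrite cE => y /i_meet; left.
Qed.

Definition glued_arc : rel V := [rel u v | [exists b, exists x : M b,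
  exists y : M b, [&& u == i b x, v == i b y & arc x y]]].

Lemma glued_arcP u v :
  reflect (exists b x y, [/\ u = i b x, v = i b y & arc x y]) (glued_arc u v).
Proof.
apply: (iffP existsP) => -[b].
  by case/existsP=> x /existsP[y /and3P[/eqP-> /eqP-> xy]]; exists b, x, y.
case=> x [y [-> -> xy]]; exists b.
by apply/existsP; exists x; apply/existsP; exists y; rewrite !eqxx.
Qed.

Lemma glued_arcE b (x y : M b) : glued_arc (i b x) (i b y) = arc x y.
Proof.
apply/glued_arcP/idP => [[c [x' [y' [ex ey]]]] | xy]; last by exists b, x, y.
case: (i_eq ex) => [[k [xk x'k]] | cb].
  case: (i_eq ey) => [[l [yl y'l]] | cb].
    by rewrite xk yl x'k y'l !arc_t.
  by move: x' y' ex ey {x'k}; rewrite cb => x' y' /i_inj -> /i_inj ->.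
by move: x' y' ex ey; rewrite cb => x' y' /i_inj -> /i_inj ->.
Qed.

Lemma glued_arc_irr : irreflexive glued_arc.
Proof.
move=> u; apply/glued_arcP=> -[b [x [y [-> /i_inj ->]]]].
by rewrite arc_irreflexive.
Qed.

Lemma glued_arc_asym u v : glued_arc u v -> ~~ glued_arc v u.
Proof.
by case/glued_arcP=> b [x [y [-> -> xy]]]; rewrite glued_arcE arc_asymmetric.
Qed.

Definition glued_graph := OrientedGraph glued_arc_irr glued_arc_asym.
Local Notation G := glued_graph.

Lemma glued_adjE b (x y : M b) : @adj G (i b x) (i b y) = adj x y.
Proof. by rewrite /adj /= !glued_arcE. Qed.

Lemma glued_adjP (u v : G) : adj u v ->
  exists b x y, [/\ u = i b x, v = i b y & adj x y].
Proof.
case/orP=> /glued_arcP[b [x [y [-> -> xy]]]].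
  by exists b, x, y; rewrite arc_adj.
by exists b, y, x; rewrite adj_sym arc_adj.
Qed.

(** The darts of the face that is removed from side [b]: the gluing replaces it
    by the other side. *)
Definition rim b : rel (M b) := [rel x y |
  [&& x \in codom (t b), y \in codom (t b) & if b then arc y x else arc x y]].

Lemma rimP b (x y : M b) : rim x y -> exists k l,
  [/\ x = t b k, y = t b l & if b then k = (l + 1)%R else l = (k + 1)%R].
Proof.
case/and3P=> /codomP[k ->] /codomP[l ->]; rewrite !arc_t => kl.
by exists k, l; split=> //; case: (b) kl => /eqP.
Qed.

Lemma rim_t b k l : rim (t b k) (t b l) = if b then (k == l + 1)%R
                                         else (l == k + 1)%R.
Proof. by rewrite /rim /= !codom_f; case: b; rewrite arc_t. Qed.

(** A dart on the rim of one side is, as a dart of the other side, directed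
    against the rim of the latter.  So each dart of the glued graph is off the
    rim for exactly one side ([glued_dart_uniq]), and this side determines its
    face. *)
Lemma glued_dart (u v : G) : adj u v ->
  exists b x y, [/\ u = i b x, v = i b y, adj x y & ~~ rim x y].
Proof.
case/glued_adjP=> b [x [y [-> -> xy]]].
have [/rimP[k [l [xk yl kl]]] | ] := boolP (rim x y); last by exists b, x, y.
exists (~~ b), (t (~~ b) k), (t (~~ b) l).
rewrite xk yl !(i_t b (~~ b)) adj_t rim_t; split=> //.
  by apply: contraTneq xy => kEl; rewrite xk yl kEl adj_irr.
by case: (b) kl => /= ->; rewrite ord3_addSS.
Qed.

Lemma glued_dart_uniq b c (x y : M b) (x' y' : M c) :
    i b x = i c x' -> i b y = i c y' -> adj x y -> ~~ rim x y -> ~~ rim x' y' ->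
  i b (third x y) = i c (third x' y').
Proof.
move=> ex ey xy xyR x'y'R; case: (eqVneq c b) => cb.
  by move: x' y' ex ey {x'y'R}; rewrite cb => x' y' /i_inj <- /i_inj <-.
have [k [xk x'k]] : exists k, x = t b k /\ x' = t c k.
  by case: (i_eq ex) => // e; rewrite e eqxx in cb.
have [l [yl y'l]] : exists k, y = t b k /\ y' = t c k.
  by case: (i_eq ey) => // e; rewrite e eqxx in cb.
move: xyR x'y'R; rewrite xk yl x'k y'l !rim_t.
have: k != l by rewrite -(adj_t b) -xk -yl.
move/ord3_neq; case: (b) (c) cb => [] [] // _;
  by case/orP=> /eqP-> ; rewrite eqxx.
Qed.

Lemma glued_third_exists : exists f : G -> G -> G,
  forall b (x y : M b), adj x y -> ~~ rim x y ->
    f (i b x) (i b y) = i b (third x y).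
Proof.
have ex (d : G * G) : exists w : G, forall b (x y : M b),
    d.1 = i b x -> d.2 = i b y -> adj x y -> ~~ rim x y -> w = i b (third x y).
  case: d => u v /=; have [uv | uvN] := boolP (adj u v).
    have [b [x [y [-> -> xy xyR]]]] := glued_dart uv.
    by exists (i b (third x y)) => c x' y' *; apply: glued_dart_uniq.
  exists u => b x y ux vy xy; case/negP: uvN.
  by rewrite ux vy glued_adjE.
have [f fP] := fin_all_exists ex.
by exists (fun u v => f (u, v)) => b x y xy xyR; apply: fP.
Qed.

Lemma glued_color_exists : exists f : G -> 'I_3,
  forall b (x : M b), f (i b x) = color x.
Proof.
have ex (v : G) : exists c : 'I_3, forall b (x : M b), v = i b x -> c = color x.
  have [b [x ->]] := i_cover v; exists (color x) => c y e.
  case: (i_eq e) => [[k [-> ->]] | cb].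
    by case: (t_cyclic b k) (t_cyclic c k) => -> _ [].
  by move: y e; rewrite cb => y /i_inj->.
have [f fP] := fin_all_exists ex; exists f => b x; exact: fP.
Qed.

(** [- (k + l)] is the third colour, as [0 + 1 + 2 = 0] modulo 3. *)
Lemma rim_third_t b k l : rim (t b k) (t b l) ->
  third (t b k) (t b l) = t b (- (k + l))%R.
Proof.
rewrite rim_t; case: (b) (t b) (t_root b) => tb [_ tP] /eqP->; rewrite tP;
  by congr tb; apply/val_inj; case: (k) (l) => [[|[|[|]]] ?] // [[|[|[|]]] ?].
Qed.

Lemma rim_third b (x y : M b) : adj x y -> rim y (third x y) -> rim x y.
Proof.
move=> xy yw; have <- := third_face xy.
case/rimP: yw (yw) => k [l [-> -> kl]] /rim_third_t ->; rewrite rim_t.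
case: (b) kl => ->; apply/eqP/val_inj;
  by case: (k) (l) => [[|[|[|]]] ?] // [[|[|[|]]] ?].
Qed.

Section Third.

Variable f : G -> G -> G.
Hypothesis fE : forall b (x y : M b), adj x y -> ~~ rim x y ->
  f (i b x) (i b y) = i b (third x y).

Lemma glued_third_adj (u v : G) : adj u v -> adj v (f u v).
Proof.
case/glued_dart=> b [x [y [-> -> xy xyR]]].
by rewrite fE // glued_adjE third_adj.
Qed.

Lemma glued_third_face (u v : G) : adj u v -> f v (f u v) = u.
Proof.
case/glued_dart=> b [x [y [-> -> xy xyR]]].
by rewrite !fE ?third_adj ?third_face //; apply: contraNN xyR; apply: rim_third.
Qed.

(** The link of a vertex of the common triangle is made of the links on both
    sides, each opened at its rim dart.  A set closed under succession that meets
    one of them reaches its end, which is the start of the other one. *)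
Lemma glued_link (v : G) (P : pred G) :
  (exists2 u, adj u v & P u) -> (forall u, adj u v -> P u -> P (f u v)) ->
  forall u, adj u v -> P u.
Proof.
move=> Pv Pf.
have Pf' b (x y : M b) : i b y = v -> adj x y -> ~~ rim x y -> P (i b x) ->
    P (i b (third x y)).
  move=> yv xy xyR Px; rewrite -fE //; move: Pf; rewrite -yv; apply=> //.
  by rewrite glued_adjE.
have rim_hit b (x y z : M b) : i b y = v -> adj z y -> P (i b z) -> rim x y ->
    P (i b x).
  (* If [P] missed the rim neighbour, it would be closed in the whole link. *)
  move=> yv zy Pz xyR; apply/idPn => xN; move/negP: (xN); apply.
  apply: (@link_connected (M b) y (fun x => P (i b x)) _ _ x).
      by exists z.
    move=> w wy Pw; apply: Pf' => //; apply: contraNN xN => wyR.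
    suff -> : x = w by [].
    case/rimP: xyR wyR => k [l [-> -> kl]] /rimP[k' [l' [-> /t_inj <- kl']]].
    by move: kl kl'; case: (b) => -> => [->|/addIr->].
  case/rimP: xyR => k [l [-> -> kl]]; rewrite adj_t.
  by case: (b) kl => ->; rewrite ?ord3_addS // eq_sym ord3_addS.
have side b (y : M b) : i b y = v -> (exists2 z, adj z y & P (i b z)) ->
    forall x, adj x y -> P (i b x).
  move=> yv [z zy Pz].
  apply: (@link_connected (M b) y (fun x => P (i b x))); first by exists z.
  move=> x xy /= Px; have [xyR | xyR] := boolP (rim x y); last exact: Pf'.
  have [k [l [xk yl kl]]] := rimP xyR.
  have klR : rim (t b k) (t b l) by rewrite -xk -yl.
  rewrite xk yl (rim_third_t klR) (i_t b (~~ b)).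
  apply: (rim_hit (~~ b) _ (t (~~ b) l) (t (~~ b) k)).
  - by rewrite -yv yl (i_t b (~~ b)).
  - by rewrite adj_t -(adj_t b) -xk -yl.
  - by rewrite (i_t _ b) -xk.
  rewrite rim_t.
  case: (b) kl => -> /=; apply/eqP/val_inj;
    by case: (k) (l) => [[|[|[|]]] ?] // [[|[|[|]]] ?].
case: Pv => u uv Pu w wv.
have [c [z [y' [uz vy' zy']]]] := glued_adjP uv.
have [b [x [y [-> vy xy]]]] := glued_adjP wv.
apply: (side b y _ _ x xy) => //.
have Pc x' : adj x' y' -> P (i c x').
  by apply: (side c y') => //; exists z => //; rewrite -uz.
move: vy; rewrite {1}vy' => /esym e; case: (i_eq e) => [[k [-> y'k]] | cb].
  exists (t b (k + 1)%R); first by rewrite adj_t eq_sym ord3_addS.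
  by rewrite (i_t b c) Pc // y'k adj_t eq_sym ord3_addS.
move: y' z e uz vy' zy' Pc; rewrite cb => y' z /i_inj-> uz _ zy' _.
by exists z; rewrite -?uz.
Qed.

Lemma glued_connected (u v : G) : connect (@adj G) u v.
Proof.
have side b (x y : M b) : connect (@adj G) (i b x) (i b y).
  have /connectP[p xp ->] := map_connected x y.
  elim: p x xp => [|z p IHp] x /=; first by rewrite connect0.
  case/andP=> xz /IHp; apply: connect_trans; apply: connect1.
  by rewrite glued_adjE.
have [[b [x ->]] [c [y ->]]] := (i_cover u, i_cover v).
apply: connect_trans (side b x (t b 0%R)) _.
by rewrite (i_t b c) side.
Qed.

End Third.

Definition arcs_in b : {set V * V} :=
  [set (i b d.1, i b d.2) | d in [set d : M b * M b | arc d.1 d.2]].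

Lemma arcs_inP b u v :
  reflect (exists x y, [/\ u = i b x, v = i b y & arc x y])
          ((u, v) \in arcs_in b).
Proof.
apply: (iffP imsetP) => [[[x y]] | [x [y [-> -> xy]]]].
  by rewrite inE /= => xy [-> ->]; exists x, y.
by exists (x, y); rewrite ?inE.
Qed.

Lemma glued_arcs :
  [set d : G * G | arc d.1 d.2] = arcs_in true :|: arcs_in false.
Proof.
apply/setP=> -[u v]; rewrite !inE; apply/glued_arcP/orP.
  by case=> b uvb; case: b uvb => uvb; [left | right]; apply/arcs_inP.
by case=> /arcs_inP; [exists true | exists false].
Qed.

Lemma arcs_shared u v : ((u, v) \in arcs_in true :&: arcs_in false) =
  [exists k, (u == i true (t true k)) && (v == i true (t true (k + 1)%R))].
Proof.
rewrite inE; apply/andP/existsP => [[] | [k /andP[/eqP-> /eqP->]]].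
  move=> /arcs_inP[x [y [-> -> xy]]] /arcs_inP[x' [y' [ex ey _]]].
  have [[k [xk _]] | //] := i_eq ex; have [[l [yl _]] | //] := i_eq ey.
  by exists k; move: xy; rewrite xk yl arc_t => /eqP<-; rewrite !eqxx.
have arck b : arc (t b k) (t b (k + 1)%R) by rewrite arc_t.
split; apply/arcs_inP; first by exists (t true k), (t true (k + 1)%R).
by exists (t false k), (t false (k + 1)%R); rewrite -!(i_t true).
Qed.

Lemma card_arcs_in b : #|arcs_in b| = #|[set d : M b * M b | arc d.1 d.2]|.
Proof. by rewrite card_imset // => -[x y] [x' y'] [/i_inj-> /i_inj->]. Qed.

Lemma card_glued_arcs : #|[set d : G * G | arc d.1 d.2]| + 3 =
  #|[set d : M true * M true | arc d.1 d.2]| +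
  #|[set d : M false * M false | arc d.1 d.2]|.
Proof.
rewrite -!card_arcs_in -cardsUI glued_arcs; congr (_ + _).
pose g k := (i true (t true k), i true (t true (k + 1)%R)).
rewrite (_ : _ :&: _ = [set g k | k in 'I_3]).
  by rewrite card_imset ?card_ord // => k l [/i_inj/t_inj].
apply/setP=> -[u v]; rewrite arcs_shared; apply/existsP/imsetP.
  by case=> k /andP[/eqP-> /eqP->]; exists k.
by case=> k _ [-> ->]; exists k; rewrite !eqxx.
Qed.

Lemma card_glued : #|V| + 3 = #|M true| + #|M false|.
Proof.
have cardi b : #|[set i b x | x in M b]| = #|M b| by rewrite card_imset.
rewrite -!cardi -cardsUI; congr (_ + _).
  rewrite -cardsT; congr #|pred_of_set _|; apply/esym/setP=> v; rewrite !inE.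
  by have [[] [x ->]] := i_cover v; apply/orP;
    [left | right]; apply/imsetP; exists x.
rewrite (_ : _ :&: _ = [set i true (t true k) | k in 'I_3]).
  by rewrite card_imset ?card_ord // => k l /i_inj/t_inj.
apply/setP=> v; rewrite inE; apply/andP/imsetP => [[] | [k _ ->]].
  case/imsetP=> x _ -> /imsetP[y _ e].
  by have [[k [-> _]] | //] := i_eq e; exists k.
split; first by apply/imsetP; exists (t true k).
by apply/imsetP; exists (t false k); rewrite // (i_t true false).
Qed.

Lemma glued_euler : #|[set d : G * G | arc d.1 d.2]| + 6 = 3 * #|G|.
Proof.
have euler_add v e n1 n2 e1 e2 : v + 3 = n1 + n2 -> e + 3 = e1 + e2 ->
  e1 + 6 = 3 * n1 -> e2 + 6 = 3 * n2 -> e + 6 = 3 * v by lia.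
exact: euler_add card_glued card_glued_arcs (map_euler _) (map_euler _).
Qed.

Lemma out_degree_sum v : @out_degree G v +
    #|[set u | (v, u) \in arcs_in true :&: arcs_in false]| =
  #|[set u | (v, u) \in arcs_in true]| + #|[set u | (v, u) \in arcs_in false]|.
Proof.
rewrite -cardsUI; congr (_ + _); apply: eq_card => u; last by rewrite !inE.
by have := glued_arcs => /setP/(_ (v, u)); rewrite !inE.
Qed.

Lemma in_degree_sum v : @in_degree G v +
    #|[set u | (u, v) \in arcs_in true :&: arcs_in false]| =
  #|[set u | (u, v) \in arcs_in true]| + #|[set u | (u, v) \in arcs_in false]|.
Proof.
rewrite -cardsUI; congr (_ + _); apply: eq_card => u; last by rewrite !inE.
by have := glued_arcs => /setP/(_ (u, v)); rewrite !inE.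
Qed.

Lemma balanced_in b v :
  #|[set u | (u, v) \in arcs_in b]| = #|[set u | (v, u) \in arcs_in b]|.
Proof.
have [/codomP[x ->] | vN] := boolP (v \in codom (i b)); last first.
  rewrite !eq_card0 // => u; rewrite inE; apply: contraNF vN.
    by case/arcs_inP=> x [y [-> _ _]]; apply: codom_f.
  by case/arcs_inP=> x [y [_ -> _]]; apply: codom_f.
have := map_balanced x; rewrite /in_degree /out_degree.
rewrite -(card_imset _ (@i_inj b)) -(card_imset [set u | arc x u] (@i_inj b)).
congr (_ = _); congr #|pred_of_set _|; apply/setP=> u; rewrite inE.
  apply/imsetP/arcs_inP=> [[y] | [y [x' [-> /i_inj <- yx]]]].
    by rewrite inE => yx ->; exists y, x.
  by exists y; rewrite ?inE.
apply/imsetP/arcs_inP=> [[y] | [x' [y [/i_inj <- -> yx]]]].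
  by rewrite inE => yx ->; exists x, y.
by exists y; rewrite ?inE.
Qed.

(** The arcs counted twice form a directed triangle, which is balanced. *)
Lemma balanced_shared v :
  #|[set u | (u, v) \in arcs_in true :&: arcs_in false]| =
  #|[set u | (v, u) \in arcs_in true :&: arcs_in false]|.
Proof.
pose w k := i true (t true k).
have w_inj : injective w by move=> k l /i_inj/t_inj.
have [/codomP[k ->] | vN] := boolP (v \in codom w); last first.
  rewrite !eq_card0 // => u; rewrite inE arcs_shared; apply: contraNF vN.
    by case/existsP=> k /andP[/eqP-> _]; apply: (codom_f w).
  by case/existsP=> k /andP[_ /eqP->]; apply: (codom_f w).
transitivity 1%N.
  apply/eqP/cards1P; exists (w (k + 1 + 1)%R); apply/setP=> u.
  rewrite inE arcs_shared inE; apply/existsP/eqP => [[l] | ->].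
    by case/andP=> /eqP-> /eqP/w_inj->; rewrite ord3_add3.
  by exists (k + 1 + 1)%R; rewrite ord3_add3 !eqxx.
apply/esym/eqP/cards1P; exists (w (k + 1)%R); apply/setP=> u.
rewrite inE arcs_shared inE; apply/existsP/eqP => [[l] | ->].
  by case/andP=> /eqP/w_inj-> /eqP->.
by exists k; rewrite !eqxx.
Qed.

Lemma glued_balanced (v : G) : in_degree v = out_degree v.
Proof.
apply/eqP.
rewrite -(eqn_add2r #|[set u | (v, u) \in arcs_in true :&: arcs_in false]|).
by rewrite out_degree_sum -balanced_shared in_degree_sum !balanced_in.
Qed.

Section Map.

Variables (f : G -> G -> G) (c : G -> 'I_3).
Hypothesis fE : forall b (x y : M b), adj x y -> ~~ rim x y ->
  f (i b x) (i b y) = i b (third x y).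
Hypothesis cE : forall b (x : M b), c (i b x) = color x.

Lemma glued_proper (u v : G) : arc u v -> c u != c v.
Proof. by case/glued_arcP=> b [x [y [-> -> /color_proper]]]; rewrite !cE. Qed.

Definition glued_map := EulerianMap (glued_third_adj fE) (glued_third_face fE)
  (glued_link fE) glued_connected glued_balanced glued_euler glued_proper.
Local Notation N := glued_map.

Variable A : {set N}.
Hypothesis A_adm : admissible A.

(** Each side keeps a face: the one across an edge of the removed face. *)
Lemma meets_side b : exists x : M b, i b x \in A.
Proof.
pose x := t b (if b then 0 else 1)%R; pose y := t b (if b then 1 else 0)%R.
have xy : adj x y by rewrite adj_t; case: (b).
have xyR : ~~ rim x y by rewrite rim_t; case: (b).
have [permA _ _] := A_adm.
have := permA (i b x) (i b y); rewrite glued_adjE => /(_ xy).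
rewrite [third _ _]fE //.
by case/or3P; eexists; eassumption.
Qed.

(** The triangle separates the sides, and [A] is connected and meets both. *)
Lemma meets_root : exists k b, i b (t b k) \in A.
Proof.
have [_ _ [_ conA]] := A_adm.
have [/existsP[k kA] | /existsPn kA] :=
  boolP [exists k, i true (t true k) \in A]; first by exists k, true.
have [[x xA] [y yA]] := (meets_side true, meets_side false).
suff /codomP[z e] : i false y \in codom (i true).
  case: (i_eq e) => [[k [yk _]] | //].
  by exists k, false; rewrite -yk.
have /connectP[p xp ->] := conA _ _ xA yA.
have: i true x \in codom (i true) by apply: codom_f.
elim: p (i true x : N) xp => //= v p IHp u /andP[/and3P[uA vA uv] vp] ui.
apply: (IHp v vp); have [b [z [w [uz -> zw]]]] := glued_adjP uv.
case: b z w uz zw => z w uz zw; first exact: codom_f.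
case/codomP: ui => z' uz'; have e := etrans (esym uz') uz.
case: (i_eq e) => [[k [z'k _]] | //].
by case/negP: (kA k); rewrite -z'k -uz'.
Qed.

Lemma meets_root_in b : exists k, i b (t b k) \in A.
Proof. by have [k [c' kA]] := meets_root; exists k; rewrite (i_t b c'). Qed.

(** Permeation could only fail on the removed face, which [A] meets by
    [meets_root].  For connectedness, a walk in [A] is followed from side [b]:
    while it is on the other side, the invariant [near] remembers the vertex of the
    triangle through which it left, and this vertex is equal or adjacent to the
    one through which it comes back. *)
Lemma restrict b : @admissible (M b) (i b @^-1: A).
Proof.
have [permA acA [_ conA]] := A_adm.
split.
- move=> x y xy; rewrite !inE.
  have [xyR | xyR] := boolP (rim x y); last first.
    have := permA (i b x) (i b y); rewrite glued_adjE => /(_ xy).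
    by rewrite [third _ _]fE.
  have [k kA] := meets_root_in b.
  have [l [m [xl ym lm]]] := rimP xyR.
  have lmR : rim (t b l) (t b m) by rewrite -xl -ym.
  have : l != m by rewrite -(adj_t b) -xl -ym.
  move/ord3_third/(_ k); rewrite xl ym (rim_third_t lmR).
  by case/or3P=> /eqP <-; rewrite kA ?orbT.
- move=> s s0 sA /andP[s_cyc s_uniq].
  apply: (acA [seq i b x | x <- s]); first by case: s s0 {sA s_cyc s_uniq}.
    by move=> _ /mapP[x /sA xA ->]; rewrite inE in xA.
  rewrite /ucycle (map_inj_uniq (@i_inj b)) s_uniq andbT.
  case: s {s0 sA s_uniq} s_cyc => //= x s.
  rewrite -map_rcons path_map; apply: sub_path => y z /=.
  by rewrite glued_arcE.
split.
  have [x xA] := meets_side b.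
  by apply/set0Pn; exists x; rewrite inE.
set e := [rel _ _ | _].
move=> x y; rewrite !inE => xA yA.
have /connectP[p xp pE] := conA _ _ xA yA.
pose near (u : N) := (forall z, u = i b z -> connect e x z) /\
  (u \notin codom (i b) -> exists2 k, i b (t b k) \in A & connect e x (t b k)).
suff: near (i b y) by case=> /(_ y erefl).
rewrite pE.
have: near (i b x).
  split=> [z /i_inj <- | ]; first by rewrite connect0.
  by rewrite codom_f.
elim: p (i b x : N) xp {pE} => //= v p IHp u /andP[/and3P[uA vA uv] vp] [nu nu'].
apply: (IHp v vp); have [d [z [w [uz vw zw]]]] := glued_adjP uv.
split=> [w' vw' | vN].
  have [/codomP[z' uz'] | uN] := boolP (u \in codom (i b)).
    apply: connect_trans (nu z' uz') (connect1 _).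
    by rewrite /= !inE -uz' -vw' uA vA -glued_adjE -uz' -vw' uv.
  have [k kA xk] := nu' uN; apply: connect_trans xk _.
  have e' := etrans (esym vw') vw; case: (i_eq e') => [[m [w'm _]] | db].
    rewrite w'm; have [-> // | km] := eqVneq k m.
    by apply: connect1; rewrite /= !inE kA -w'm -vw' vA w'm adj_t.
  by case/negP: uN; move: z uz {zw}; rewrite db => z ->; apply: codom_f.
have [/codomP[z' uz'] | uN] := boolP (u \in codom (i b)); last exact: nu'.
have e' := etrans (esym uz') uz; case: (i_eq e') => [[k [z'k _]] | db].
  by exists k; rewrite -z'k -?uz' //; apply: nu.
by case/negP: vN; move: w vw {zw}; rewrite db => w ->; apply: codom_f.
Qed.

(** The boundary of a black root follows the arcs, while the rim of the white
    side goes against them, so this face is not the removed one. *)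
Lemma glued_black_root (s : 'I_3 -> M true) :
  black_root s -> @black_root N (i true \o s).
Proof.
case=> s_cyc s_third; split=> k; have [sk arck] := s_cyc k.
  by rewrite /= cE sk glued_arcE.
rewrite /= fE ?s_third //; first exact: arc_adj.
by rewrite /rim /= (negPf (arc_asymmetric arck)) !andbF.
Qed.

End Map.
End Gluing.

Lemma gluing (M1 M2 : eulerian_map) t1 t2 s :
    @black_root M1 t1 -> @white_root M2 t2 -> @black_root M2 s ->
  exists (N : eulerian_map) (i : M1 -> N) (j : M2 -> N),
  [/\ injective i /\ injective j,
      (forall x, color (i x) = color x) /\ (forall y, color (j y) = color y),
      forall x y, i x = j y -> exists k, y = t2 k,
      black_root (j \o s) &
      forall A : {set N}, admissible A ->
        admissible (i @^-1: A) /\ admissible (j @^-1: A)].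
Proof.
move=> t1P t2P sP.
have [V [i [j [i_inj j_inj ijE ij_meet ij_cover]]]] :=
  amalgam (triangle_inj (proj1 t1P)) (triangle_inj (proj1 t2P)).
pose M b := if b then M2 else M1.
pose h b : M b -> V := if b return M b -> V then j else i.
pose t b : 'I_3 -> M b := if b return 'I_3 -> M b then t2 else t1.
have t_root b : seam (t b) b by case: b.
have h_inj b : injective (h b) by case: b.
have h_t b c k : h b (t b k) = h c (t c k).
  by case: b c => [] [] //=; rewrite ijE.
have h_meet b (x : M b) (y : M (~~ b)) :
    h b x = h (~~ b) y -> exists k, x = t b k /\ y = t (~~ b) k.
  case: b x y => x y /=; last exact: ij_meet.
  by move/esym/ij_meet=> [k [-> ->]]; exists k.
have h_cover v : exists b x, v = h b x.
  by case: (ij_cover v) => -[x ->]; [exists false, x | exists true, x].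
have [f fE] := glued_third_exists t_root h_inj h_t h_meet.
have [c cE] := glued_color_exists t_root h_inj h_meet h_cover.
exists (glued_map h_t h_cover fE cE), i, j; split=> //.
- by split=> x; [exact: (cE false) | exact: (cE true)].
- by move=> x y /ij_meet[k [_ ->]]; exists k.
- exact: glued_black_root.
move=> A A_adm.
by split; [exact: (restrict A_adm false) | exact: (restrict A_adm true)].
Qed.

(** A cyclic shift of the colours keeps their cyclic order around each face, hence
    the class of the face. *)
Section Recoloring.
Variables (M : eulerian_map) (c : 'I_3).

Lemma recolor_proper (u v : M) : arc u v -> (color u + c != color v + c)%R.
Proof. by move/color_proper; apply: contraNN => /eqP/addIr->. Qed.

Definition recolor := EulerianMap (@third_adj M) (@third_face M)
  (@link_connected M) (@map_connected M) (@map_balanced M) (map_euler M)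
  recolor_proper.

Lemma recolor_root b (t : 'I_3 -> M) :
  seam t b -> @seam recolor (fun k => t (k - c)%R) b.
Proof.
have cyc : cyclic_triangle t -> @cyclic_triangle recolor (fun k => t (k - c)%R).
  by move=> tP k; have [tk] := tP (k - c)%R; rewrite /= tk subrK addrAC.
by case: b => -[/cyc t_cyc t_third]; split=> // k /=;
  rewrite !(addrAC _ 1%R (- c)%R).
Qed.

End Recoloring.


(** * The block *)

(** The vertices are the integers below 22, in six groups of at most four, so
    that a table and a computation settle each of its local properties. *)
Definition vp i := i %% 4.
Definition vq i := 4 + i %% 4.
Definition vr i := 8 + i %% 4.
Definition va i := 12 + i %% 4.
Definition vb i := 16 + i %% 4.
Definition vc i := 20 + i %% 2.

(** Out-neighbours.  Beyond the equator and its twins, the arcs are chosen so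
    that all vertices are balanced and the triangles [outer] and [inner] are
    directed cycles. *)
Definition outs (n : nat) : seq nat :=
  let i := n %% 4 in
  match n %/ 4 with
  | 0 => [:: vp i.+1; vq i.+1; vb i; vb (i + 3); vc (i + 3)]
  | 1 => [:: vp i.+1; vr i; va i]
  | 2 => [:: vp i; va i]
  | 3 => [:: vp (i + 3); vp i]
  | 4 => [:: vq i; vr i]
  | _ => [:: vq i; vq i.+2]
  end.

(** The neighbours of a vertex in cyclic order.  The rotation by one step along the
    equator exchanges its two sides and so reverses the orientation of the plane,
    whence the reversal for odd indices. *)
Definition link (n : nat) : seq nat :=
  let i := n %% 4 in
  let s := match n %/ 4 with
  | 0 => [:: vp i.+1; vb i; vr i; va i; vp (i + 3); vb (i + 3); vq (i + 3);
             vc (i + 3); vq i.+1; va i.+1]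
  | 1 => [:: vp (i + 3); va i; vr i; vb i; vp i.+1; vc i]
  | 2 => [:: vp i; vb i; vq i; va i]
  | 3 => [:: vp (i + 3); vp i; vr i; vq i]
  | 4 => [:: vp i; vp i.+1; vq i; vr i]
  | _ => [:: vq i; vp i.+1; vq i.+2; vp (i + 3)]
  end in
  if odd n then rev s else s.

Definition block_arc : rel 'I_22 := [rel x y : 'I_22 | val y \in outs x].

Definition block_third (x y : 'I_22) : 'I_22 := inZp (next (link y) x).

Definition hue (n : nat) : 'I_3 :=
  inZp (if n < 8 then n %% 2 else if n < 12 then n.+1 %% 2 else 2).

Definition block_color (x : 'I_22) := hue x.

Lemma ord_all n (P : pred nat) : all P (iota 0 n) -> forall x : 'I_n, P x.
Proof. by move/allP=> PP x; apply: PP; rewrite mem_iota ltn_ord. Qed.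

Lemma block_irr : irreflexive block_arc.
Proof.
move=> x; apply/negbTE; move: x.
exact: (ord_all (n := 22) (P := fun x => x \notin outs x)).
Qed.

Lemma ord_all2 n (P : rel nat) :
  all (fun x => all (P x) (iota 0 n)) (iota 0 n) -> forall x y : 'I_n, P x y.
Proof. by move/ord_all=> PP x; apply/ord_all/PP. Qed.

Lemma block_asym x y : block_arc x y -> ~~ block_arc y x.
Proof.
apply/implyP; move: x y.
apply: (@ord_all2 22 (fun x y => (y \in outs x) ==> (x \notin outs y))).
by vm_compute.
Qed.

Definition block_graph := OrientedGraph block_irr block_asym.

Definition adj_nat x y := (y \in outs x) || (x \in outs y).

Lemma adj_link (x y : block_graph) : adj x y = (val x \in link y).
Proof.
apply/eqP; move: x y.
by apply: (@ord_all2 22 (fun x y => adj_nat x y == (x \in link y))); vm_compute.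
Qed.

Lemma link_uniq (x : 'I_22) : uniq (link x).
Proof.
by move: x; apply: (@ord_all 22 (fun x => uniq (link x))); vm_compute.
Qed.

Lemma link_small (x : 'I_22) : all (fun y => y < 22) (link x).
Proof.
move: x; apply: (@ord_all 22 (fun x => all (fun y => y < 22) (link x))).
by vm_compute.
Qed.

Lemma block_thirdE (x y : block_graph) : adj x y ->
  val (block_third x y) = next (link y) x.
Proof.
rewrite adj_link => xy /=; rewrite modn_small //.
by apply: (allP (link_small y)); rewrite mem_next.
Qed.

Lemma block_third_adj (x y : block_graph) : adj x y -> adj y (block_third x y).
Proof.
move=> xy; rewrite adj_sym adj_link block_thirdE // mem_next.
by rewrite -adj_link.
Qed.

Lemma block_third_face (x y : block_graph) :
  adj x y -> block_third y (block_third x y) = x.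
Proof.
move=> xy; apply: val_inj; rewrite block_thirdE ?block_third_adj //.
rewrite (block_thirdE xy); apply/eqP; rewrite adj_link in xy.
move: xy; apply/implyP; move: x y.
apply: (@ord_all2 22 (fun x y => (x \in link y) ==>
  (next (link (next (link y) x)) y == x))).
by vm_compute.
Qed.

Lemma block_link (y : block_graph) (P : pred block_graph) :
  (exists2 x, adj x y & P x) ->
  (forall x, adj x y -> P x -> P (block_third x y)) ->
  forall x, adj x y -> P x.
Proof.
move=> [x xy Px] P_third z zy.
(* The degrees are at most 10. *)
have /trajectP[n _ zE] : val z \in traject (next (link y)) x 10.
  rewrite !adj_link in xy zy; apply: (allP (allP _ _ xy) _ zy).
  move: (y); apply: (@ord_all 22 (fun y => all (fun x =>
    all (fun z => z \in traject (next (link y)) x 10) (link y)) (link y))).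
  by vm_compute.
suff [u [uy Pu uE]] : exists u : block_graph,
    [/\ adj u y, P u & val u = iter n (next (link y)) x].
  by rewrite (val_inj (etrans zE (esym uE))).
elim: n {zE} => [|n [u [uy Pu uE]]]; first by exists x.
exists (block_third u y); split; last by rewrite block_thirdE // uE iterS.
  by rewrite adj_sym block_third_adj.
exact: P_third.
Qed.

Lemma block_connected0 (x : block_graph) : connect (@adj _) x (ord0 : 'I_22).
Proof.
have lower (y : block_graph) :
    val y != 0 -> exists2 z : block_graph, adj y z & z < y.
  have : (val y != 0) ==> has (adj_nat y) (iota 0 y).
    move: y.
    apply: (@ord_all 22 (fun y => (y != 0) ==> has (adj_nat y) (iota 0 y))).
    by vm_compute.
  move=> /implyP/[apply]/hasP[z]; rewrite mem_iota => /= zy yz.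
  by exists (Ordinal (ltn_trans zy (ltn_ord y))).
have [n] := ubnP (val x); elim: n x => // n IHn x xn.
have [x0 | /lower[y xy yx]] := eqVneq (val x) 0.
  by rewrite (_ : x = ord0) ?connect0 //; apply: val_inj.
by apply: connect_trans (connect1 xy) (IHn y _); apply: leq_trans yx _.
Qed.

Lemma block_connected (x y : block_graph) : connect (@adj _) x y.
Proof.
apply: connect_trans (block_connected0 x) _.
by rewrite (sym_connect_sym (@adj_sym _)) block_connected0.
Qed.

Lemma card_ord_count n (P : pred nat) :
  #|[set x : 'I_n | P x]| = count P (iota 0 n).
Proof.
by rewrite cardsE cardE /enum_mem size_filter -val_enum_ord count_map enumT.
Qed.

Definition vert (n : nat) : block_graph := inZp n.

Lemma block_degrees (x : block_graph) :
  in_degree x = out_degree x.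
Proof.
rewrite /in_degree /out_degree.
rewrite (card_ord_count _ (fun y => val x \in outs y)).
rewrite (card_ord_count _ (fun y => y \in outs x)); apply/eqP; move: x.
apply: (@ord_all 22 (fun x => count (fun y => x \in outs y) (iota 0 22) ==
  count (fun y => y \in outs x) (iota 0 22))).
by vm_compute.
Qed.

Lemma block_euler :
  #|[set d : block_graph * block_graph | arc d.1 d.2]| + 6 = 3 * #|block_graph|.
Proof.
have -> : #|block_graph| = 22 by rewrite card_ord.
rewrite -sum1dep_card -(pair_big_dep xpredT (@block_arc) (fun _ _ => 1)) /=.
under eq_bigr => x _ do
  rewrite sum1dep_card (card_ord_count _ (fun y => y \in outs x)).
rewrite -(big_mkord xpredT
  (fun x => count (fun y => y \in outs x) (iota 0 22))).
by rewrite unlock; vm_compute.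
Qed.

Lemma block_proper (x y : block_graph) :
  arc x y -> block_color x != block_color y.
Proof.
apply/implyP; move: x y.
apply: (@ord_all2 22 (fun x y => (y \in outs x) ==> (hue x != hue y))).
by vm_compute.
Qed.

Definition block := EulerianMap block_third_adj block_third_face
  block_link block_connected block_degrees block_euler block_proper.

(** The faces q_0 p_1 c_0 and q_0 p_1 b_0.  They lie on the two sides of the edge
    q_0 p_1, hence one is a white and the other one a black root. *)
Definition outer (k : 'I_3) : block := vert (nth 0 [:: vq 0; vp 1; vc 0] k).
Definition inner (k : 'I_3) : block := vert (nth 0 [:: vq 0; vp 1; vb 0] k).

Lemma outer_root : white_root outer.
Proof.
split=> [k|k]; first split; last by apply: val_inj; case: k => [[|[|[|]]]].
  by apply: val_inj; case: k => [[|[|[|]]]].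
by case: k => [[|[|[|]]]].
Qed.

Lemma inner_root : black_root inner.
Proof.
split=> [k|k]; first split; last by apply: val_inj; case: k => [[|[|[|]]]].
  by apply: val_inj; case: k => [[|[|[|]]]].
by case: k => [[|[|[|]]]].
Qed.

Lemma connected_nbr (G : oriented_graph) (A : {set G}) x y :
    connected_set A -> x \in A -> y \in A -> x != y ->
  exists2 z, z \in A & adj x z.
Proof.
move=> [_ conA] xA yA; have /connectP[[|z s] /= xs ->] := conA x y xA yA.
  by rewrite eqxx.
by case/andP: xs => /and3P[_ zA xz] _ _; exists z.
Qed.

Section Forcing.
(** The vertices numbered from 12 to 19 are the a_i and b_i.  The aim is to
    refute these hypotheses ([forcing]). *)
Variable A : {set block}.
Hypothesis A_adm : admissible A.
Hypothesis A_noab : forall x : block, 12 <= val x < 20 -> x \notin A.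

Let m n := vert n \in A.

Lemma edge_cover x y : adj (vert x) (vert y) ->
  12 <= val (block_third (vert x) (vert y)) < 20 -> m x || m y.
Proof.
move=> xy /A_noab zA; have [/(_ _ _ xy) + _ _] := A_adm.
by rewrite [third _ _]/(block_third _ _) (negPf zA) orbF.
Qed.

Lemma no_cycle s : s != [::] -> ucycle (@arc block) (map vert s) -> ~~ all m s.
Proof.
move=> s0 s_cyc; have [_ acA _] := A_adm; apply/negP=> /allP sA.
apply: (acA (map vert s)) s_cyc; first by case: (s) s0.
by move=> _ /mapP[x /sA xA ->].
Qed.

Lemma pp_cover i : i < 4 -> m (vp i) || m (vp i.+1).
Proof. by case: i => [|[|[|[|]]]] // _; apply: edge_cover. Qed.

Lemma r_cover i : i < 6 -> (m (vp i) || m (vr i)) && (m (vq i) || m (vr i)).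
Proof.
by case: i => [|[|[|[|[|[|]]]]]] // _; apply/andP; split; apply: edge_cover.
Qed.

(** The index [i.+2], for [i < 4], is used without reduction modulo 4, hence the
    bound 6 here and in [r_cover]. *)
Lemma r_connected i j : i < 6 -> m (vr i) -> m (vp j) -> m (vp i) || m (vq i).
Proof.
move=> i6 rA pA; have [_ _ conA] := A_adm.
have small n : n < 22 -> val (vert n) = n by move=> lt22; rewrite /= modn_small.
have j4 := ltn_pmod j (isT : 0 < 4); have i4 := ltn_pmod i (isT : 0 < 4).
have rp : vert (vr i) != vert (vp j).
  by rewrite -val_eqE !small /vr /vp; lia.
have [z zA rz] := connected_nbr conA rA pA rp.
have links :
    all (fun z => [|| z == vp i, z == vq i | 12 <= z < 20]) (link (vr i)).
  by case: (i) i6 => [|[|[|[|[|[|]]]]]].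
move: rz; rewrite adj_sym adj_link small; last by rewrite /vr; lia.
move/(allP links)=> /or3P[/eqP zE | /eqP zE | zab].
- rewrite /m (_ : vert (vp i) = z) ?zA //; apply: val_inj.
  by rewrite zE small // /vp; lia.
- rewrite /m (_ : vert (vq i) = z) ?zA ?orbT //; apply: val_inj.
  by rewrite zE small // /vq; lia.
by have := A_noab zab; rewrite zA.
Qed.

(** The key step: once p_i is missed, q_i takes its place, and p_(i+2) or q_(i+2)
    closes a directed 4-cycle. *)
Lemma p_in i : i < 4 -> m (vp i).
Proof.
move=> i4; apply/idPn => pN.
have pSi : m (vp i.+1) by have := pp_cover i4; rewrite (negPf pN).
have pPi : m (vp (i + 3)).
  have : m (vp i) || m (vp (i + 3)).
    by case: (i) i4 => [|[|[|[|]]]] // _; apply: edge_cover.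
  by rewrite (negPf pN).
have i6 : i < 6 by apply: leq_trans i4 _.
have qi : m (vq i).
  have := r_cover i6; rewrite (negPf pN) => /andP[/= rA _].
  by have := r_connected i6 rA pSi; rewrite (negPf pN).
have cyc1 : ~~ all m [:: vp (i + 3); vq i; vp i.+1; vq i.+2].
  by case: (i) i4 => [|[|[|[|]]]] // _; apply: no_cycle.
have cyc2 : ~~ all m [:: vp (i + 3); vq i; vp i.+1; vp i.+2].
  by case: (i) i4 => [|[|[|[|]]]] // _; apply: no_cycle.
move: cyc1 cyc2; rewrite /= pPi qi pSi /= !andbT => qN; case/negP.
have i26 : i.+2 < 6 by [].
have := r_cover i26; rewrite (negPf qN) => /andP[_ /= rA].
by have := r_connected i26 rA pSi; rewrite (negPf qN) orbF.
Qed.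

Lemma forcing : False.
Proof.
have : ~~ all m [:: vp 0; vp 1; vp 2; vp 3] by apply: no_cycle.
by rewrite /= !p_in.
Qed.

End Forcing.

Lemma block_forces A : admissible A ->
  exists2 x : block, x \in A & color x = 2%R /\ x \notin codom outer.
Proof.
move=> A_adm.
have [/exists_inP[x xA xab] | /exists_inPn noab] :=
  boolP [exists x in A, 12 <= val x < 20].
  exists x => //; move: xab; split.
    apply/eqP; move: xab; apply/implyP; move: (x).
    apply: (@ord_all 22 (fun x => (12 <= x < 20) ==> (hue x == 2%R))).
    by vm_compute.
  apply: contraL xab => /codomP[k ->].
  by case: k => [[|[|[|]]]].
case: (@forcing A A_adm) => x; apply: contraTN; exact: noab.
Qed.

(** * Iterated gluing *)

Definition forced (M : eulerian_map) (s : seq 'I_3) :=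
  forall A : {set M}, admissible A ->
  forall j, count_mem j s <= #|A :&: [set x | color x == j]|.

(** A new copy of the block is glued for each entry of [s].  Its vertex provided by
    [block_forces] is off the common triangle, hence not counted before. *)
Lemma forcing_map (s : seq 'I_3) :
  exists (M : eulerian_map) (t : 'I_3 -> M), black_root t /\ forced M s.
Proof.
elim: s => [|j s [M [t [tP Ms]]]].
  by exists block, inner; split=> //; exact: inner_root.
(* The shift that takes colour 2 to colour [j]. *)
pose d := (j - 2)%R.
have [N [f [g [[f_inj g_inj] [fc gc] meet rootN adm]]]] :=
  gluing tP (@recolor_root block d true outer outer_root)
    (@recolor_root block d false inner inner_root).
exists N, (g \o (fun k => inner (k - d)%R)); split=> // A /adm[A1 A2] l.
have := Ms _ A1 l; rewrite /= => Al.
have [x xA [x2 xout]] := @block_forces (g @^-1: A) A2.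
have gxj : color (g x) = j.
  by rewrite gc -[color _]/((color (x : block) + d)%R) x2 addrC subrK.
rewrite (cardsD1 (g x)) 2!inE gxj; move: xA; rewrite inE => ->.
apply: leq_add => //.
apply: leq_trans Al _; rewrite -(card_imset _ f_inj); apply/subset_leq_card.
apply/subsetP=> _ /imsetP[y + ->]; rewrite !inE => /andP[yA yl].
rewrite yA fc yl !andbT; apply/eqP=> /meet[k xk].
by case/negP: xout; rewrite xk codom_f.
Qed.

Theorem corollary12 (k : int) :
  exists (G : oriented_graph) (rot : G -> {perm G}) (I : 'I_3 -> {set G}),
    [/\ eulerian G, plane_triangulation rot, tripartition I &
        forall A : {set G},
          permeating rot A -> acyclic_set A -> connected_set A ->
          forall j : 'I_3, (k <= #|A :&: I j|%:Z)%R].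
Proof.
have [M [_ [_ Ms]]] := forcing_map (flatten [seq nseq `|k| j | j : 'I_3]).
exists M, (@rotation M), (fun j => [set x | color x == j]); split.
- by split; [exact: map_set_connected | exact: map_balanced].
- exact: map_triangulation.
- exact: map_tripartition.
move=> A permA acA conA j.
have A_adm : admissible A by split=> // u w; exact: map_permeating.
suff: `|k| <= #|A :&: [set x | color x == j]| by set n := #|_|; lia.
apply: leq_trans (Ms A A_adm j).
rewrite count_flatten -map_comp sumnE big_map.
rewrite (bigD1_seq j) ?mem_enum ?enum_uniq //=.
by rewrite count_nseq /= eqxx mul1n leq_addr.
Qed.
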